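(* For any integer $n \ge 2$, the number of standard monomials of $M_n^{(n-2)}$ is \[|\operatorname{stan}_n^{n-2}| = (n+1)^{n-1} + (n-1)^{n-1}.\] In particular, \[|\partial(\operatorname{stan}_n^{n-2})| = (n-1)^{n-1}.\]
   Context: Fix a field $\mathbb{K}$ and let $S = \mathbb{K}[x_1,\dots,x_n]$, $[n]=\{1,\dots,n\}$. For nonempty $\sigma \subseteq [n]$ let $m_\sigma = \prod_{i\in\sigma} x_i^{\,n-|\sigma|+1}$. For $0 \le k \le n-1$ let $M_n^{(k)} = \langle m_\sigma : \sigma \subseteq [n],\ 1 \le |\sigma| \le k+1\rangle \subset S$. The standard monomials of a monomial ideal are the monomials of $S$ not lying in the ideal; $\operatorname{stan}_n^k$ denotes the set of standard monomials of $M_n^{(k)}$. Define $\partial(\operatorname{stan}_n^{n-2}) = \operatorname{stan}_n^{n-2} \setminus \operatorname{stan}_n^{n-1}$. *)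

(* Defs.v *)
From HB Require Import structures.
From mathcomp Require Import all_boot all_algebra.
From mathcomp Require Import mpoly.
From mathcomp Require Import boolp classical_sets functions cardinality.

Set Implicit Arguments.
Unset Strict Implicit.
Unset Printing Implicit Defensive.

Import GRing.Theory.

Local Open Scope ring_scope.
Local Open Scope classical_set_scope.

(* mathcomp's [idealr_closed] only covers proper ideals, so the ideal generated
   by [G] is defined directly, as the finite combinations of elements of [G]. *)
Definition ideal_gen (R : comNzRingType) (G : set R) : set R :=
  [set p | exists (r : nat) (a g : 'I_r -> R),
     (forall j, G (g j)) /\ p = \sum_(j < r) a j * g j].

Definition m_gen (K : fieldType) (n : nat) (sigma : {set 'I_n}) : {mpoly K[n]} :=
  \prod_(i in sigma) 'X_i ^+ (n - #|sigma| + 1).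

Definition skeleton_ideal (K : fieldType) (n k : nat) : set {mpoly K[n]} :=
  ideal_gen [set m_gen K sigma | sigma in
               [set sigma : {set 'I_n} | (1 <= #|sigma| <= k + 1)%N]].
Arguments skeleton_ideal : clear implicits.

(* Monomials are taken as elements of the polynomial ring, not as exponent
   vectors. *)
Definition monomials (K : fieldType) (n : nat) : set {mpoly K[n]} :=
  range (fun m : 'X_{1..n} => 'X_[K, m]).
Arguments monomials : clear implicits.

Definition stan (K : fieldType) (n k : nat) : set {mpoly K[n]} :=
  monomials K n `\` skeleton_ideal K n k.
Arguments stan : clear implicits.

Definition bd_stan (K : fieldType) (n : nat) : set {mpoly K[n]} :=
  stan K n (n - 2) `\` stan K n (n - 1).
Arguments bd_stan : clear implicits.

(* Main.v *)
Require Import Defs.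
From HB Require Import structures.
From mathcomp Require Import all_boot all_algebra zify.
From mathcomp Require Import mpoly.
From mathcomp Require Import boolp classical_sets functions cardinality.

(* A monomial x^u avoids M_n^(k) iff, for every j in [n - k, n], at least j of
   the exponents are smaller than j.  For k = n - 1 this says that u is a parking
   function; the boundary consists of the u without zero entry that satisfy the
   condition for j >= 2, and u - 1 is then a prime parking function.  Both
   families are counted by Pollak's circular argument: by the cycle lemma, each
   function from n cars to Z/(n+1) (resp. Z/(n-1)) has exactly one rotation that
   is a parking (resp. prime parking) function. *)

Set Implicit Arguments.
Unset Strict Implicit.
Unset Printing Implicit Defensive.

Import GRing.Theory.

Local Open Scope classical_set_scope.
Local Open Scope card_scope.

(** * Ballot conditions on finite families *)

Definition below (I : finType) (u : I -> nat) (j : nat) : nat :=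
  #|[pred i | u i < j]|.

(* Parking functions on n cars are [ballot 1 n 0], prime ones [ballot 1 n.-1 1]. *)
Definition ballot (I : finType) (a b e : nat) (u : I -> nat) : bool :=
  all (fun j => j + e <= below u j) (index_iota a b.+1).

Lemma ballotP (I : finType) (a b e : nat) (u : I -> nat) :
  reflect (forall j, a <= j <= b -> j + e <= below u j) (ballot a b e u).
Proof.
apply: (iffP allP) => H j; last by rewrite mem_index_iota ltnS; apply: H.
by move=> Hj; apply: H; rewrite mem_index_iota ltnS.
Qed.

Lemma below_total (I : finType) (u : I -> nat) (j : nat) :
  (forall i, u i < j) -> below u j = #|I|.
Proof. by move=> H; apply: eq_card => i; rewrite !inE H. Qed.

Lemma below_full (I : finType) (u : I -> nat) (j : nat) :
  #|I| <= below u j -> forall i, u i < j.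
Proof.
move=> H i; have : #|I| == below u j by rewrite eqn_leq H max_card.
rewrite eq_sym => /eqP E.
by have := fintype.subset_cardP E (fintype.subset_predT _) i; rewrite !inE.
Qed.

(** * The cycle lemma, for a drift of plus one and of minus one per period *)

Lemma cycle_ballot_gain (A : nat -> nat) (m : nat) :
  0 < m -> (forall j, A (j + m) = A j + m.+1) ->
  exists! c : 'I_m, forall j, 1 <= j <= m -> A c + j.+1 <= A (c + j).
Proof.
move=> m_gt0 Aper.
(* Lexicographic weight: the chosen c is the last minimum of A j - j. *)
pose w (j : 'I_m) := (A j + (m - j)) * m + (m - j).
case: (@arg_minnP _ (Ordinal m_gt0) xpredT w isT) => c _ cmin.
have {cmin} cmin (i : 'I_m) : A c + (m - c) <= A i + (m - i) /\
    (c < i -> A c + (m - c) < A i + (m - i)).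
  move: (cmin i isT) (ltn_ord c) (ltn_ord i); rewrite /w; split; nia.
exists c; split=> [j /andP[j1 jm]|c' Hc'].
  (* Before the end of the period, [A j - j] is strictly larger than at [c] because [c] is the last
     minimum; past the end, the rise by one per period gives strictness. *)
  case: (ltnP (c + j) m) => cj.
    by case: (cmin (Ordinal cj)) => /= _; lia.
  have lt : c + j - m < m by have := ltn_ord c; lia.
  case: (cmin (Ordinal lt)) => /= H _.
  rewrite -(subnK cj) Aper; have := ltn_ord c; lia.
apply/val_inj => /=; case: (cmin c') => H1 H2.
have c'm := ltn_ord c'; have cm := ltn_ord c.
(* If [c < c'], going from [c'] on to [c + m] shows that [A j - j] is no larger at [c'] than at [c],
   against the choice of the last minimum. If [c' < c], going from [c'] to [c] puts [c'] strictly
   below the minimum. *)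
case: (ltngtP c c') => // lt.
  have := Hc' (c + m - c'); rewrite subnKC; last by lia.
  rewrite Aper; lia.
have := Hc' (c - c'); rewrite subnKC; lia.
Qed.

Lemma cycle_ballot_loss (A : nat -> nat) (n : nat) :
  (forall j, A (j + n.+1) = A j + n) ->
  exists! c : 'I_n.+1, forall j, 1 <= j <= n -> A c + j <= A (c + j).
Proof.
move=> Aper.
(* Lexicographic weight: the chosen c is the first minimum of A j - j. *)
pose w (j : 'I_n.+1) := (A j + (n.+1 - j)) * n.+1 + j.
case: (@arg_minnP _ ord0 xpredT w isT) => c _ cmin.
have {cmin} cmin (i : 'I_n.+1) : A c + (n.+1 - c) <= A i + (n.+1 - i) /\
    (i < c -> A c + (n.+1 - c) < A i + (n.+1 - i)).
  move: (cmin i isT) (ltn_ord c) (ltn_ord i); rewrite /w; split; nia.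
exists c; split=> [j /andP[j1 jm]|c' Hc'].
  (* Now [A j - j] drops by one per period; past the end this is made up for by the strictly larger
     values before the first minimum. *)
  case: (ltnP (c + j) n.+1) => cj.
    by case: (cmin (Ordinal cj)) => /= ? _; lia.
  have lt : c + j - n.+1 < n.+1 by have := ltn_ord c; lia.
  case: (cmin (Ordinal lt)) => /= _ H.
  rewrite -(subnK cj) Aper; have := ltn_ord c; lia.
apply/val_inj => /=; case: (cmin c') => H1 H2.
have c'm := ltn_ord c'; have cm := ltn_ord c.
case: (ltngtP c c') => // lt.
  have := Hc' (c + n.+1 - c'); rewrite subnKC; last by lia.
  rewrite Aper; lia.
have := Hc' (c - c'); rewrite subnKC; lia.
Qed.

(** * Rotations and the circular counts *)

Definition rot (I : finType) (m : nat) (c : 'I_m.+1) (f : {ffun I -> 'I_m.+1}) :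
  {ffun I -> 'I_m.+1} := [ffun i => (f i - c)%R].

Lemma rot_inj (I : finType) (m : nat) (c : 'I_m.+1) : injective (@rot I m c).
Proof. by move=> f g /ffunP E; apply/ffunP => i; have := E i; rewrite !ffunE => /addIr. Qed.

(* Count the pairs (f, c) with P (rot c f) in two ways. *)
Lemma card_rot_unique (I : finType) (m : nat) (P : pred {ffun I -> 'I_m.+1}) :
  (forall f, exists! c, P (rot c f)) -> #|P| * m.+1 = m.+1 ^ #|I|.
Proof.
move=> H; transitivity (\sum_(f : {ffun I -> 'I_m.+1}) \sum_(c < m.+1) (P (rot c f) : nat)).
  rewrite exchange_big /= (eq_bigr (fun=> #|P|)); last first.
    move=> c _; rewrite
      -(reindex_inj (P := predT) (F := fun f => nat_of_bool (P f)) (rot_inj (c := c))) /=.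
    by rewrite -big_mkcond /= sum1_card.
  by rewrite sum_nat_const card_ord mulnC.
rewrite (eq_bigr (fun=> 1)); last first.
  move=> f _; case: (H f) => c [Pc cuniq].
  rewrite (bigD1 c) //= Pc big1 // => d dc.
  by case Pd : (P _) => //; rewrite (cuniq d Pd) eqxx in dc.
by rewrite sum1_card card_ffun card_ord.
Qed.

(** [A] is the sequence of partial sums of the fibre sizes of [f], read periodically around the
    circle. Its increment over the window of length [j] from [c] counts the cars that the rotation
    by [c] sends below [j], so the cycle lemma applies to [A]. *)
Lemma below_rot (I : finType) (m : nat) (f : {ffun I -> 'I_m.+1}) :
  exists A : nat -> nat, (forall j, A (j + m.+1) = A j + #|I|) /\
    forall (c : 'I_m.+1) j, j <= m.+1 -> A (c + j) = A c + below (fun i => rot c f i) j.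
Proof.
pose cnt t := #|[pred i | f i == inZp t]|.
(* The start [c] ranges over all naturals, since the periodicity of [A] uses windows that start
   anywhere. *)
have key (c : nat) j : j <= m.+1 ->
    \sum_(t < j) cnt (c + t) = below (fun i => rot (inZp c) f i) j.
  elim: j => [|j IH] jm.
    by rewrite big_ord0 /below eq_card0.
  rewrite big_ord_recr /= IH; last by lia.
  (* The cars with rotated value below [j] and the fibre over [c + j], whose rotated value is [j],
     are disjoint. *)
  rewrite /below /cnt -cardUI addnC eq_card0 ?add0n; last first.
    move=> i; rewrite !inE; apply/negP => /andP[lt /eqP E]; move: lt.
    rewrite ffunE E.
    have -> : (inZp (c + j) - inZp c : 'I_m.+1)%R = inZp j.
      by apply/(canLR (addrK _)); apply: val_inj; rewrite /= modnDm addnC.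
    by rewrite /= modn_small // ltnn.
  apply: eq_card => i; rewrite !inE ltnS [in RHS]leq_eqVlt orbC; congr (_ || _).
  rewrite ffunE.
  have -> : (inZp (c + j) = inZp j + inZp c :> 'I_m.+1)%R.
    by apply: val_inj; rewrite /= modnDm addnC.
  rewrite -subr_eq -(inj_eq val_inj) /=.
  by rewrite (modn_small (m := j)) //.
pose A j := \sum_(t < j) cnt t.
have AD c j : A (c + j) = A c + \sum_(t < j) cnt (c + t).
  by rewrite /A big_split_ord.
exists A; split.
- by move=> j; rewrite AD key // below_total.
- by move=> c j jm; rewrite AD key // valZpK.
Qed.

Lemma card_parking (n : nat) : 0 < n ->
  #|[pred f : {ffun 'I_n -> 'I_n.+1} | ballot 1 n 0 (fun i => f i)]| = n.+1 ^ n.-1.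
Proof.
move=> n_gt0; apply/eqP; rewrite -(eqn_pmul2r (ltn0Sn n)) -expnSr prednK //.
rewrite -[X in _ == _ ^ X](card_ord n); apply/eqP; apply: card_rot_unique => f.
have [A [Aper AE]] := below_rot f; rewrite card_ord in Aper.
have [c [Hc cuniq]] := cycle_ballot_loss Aper.
exists c; split=> [|d].
  by apply/ballotP => j jn; rewrite addn0 -(leq_add2l (A c)) -AE ?Hc //; lia.
move/ballotP => Hd; apply: cuniq => j jn.
by have := Hd j jn; rewrite addn0 AE ?leq_add2l //; lia.
Qed.

(** The prime condition at [m.+1] already puts all [m.+2] cars below [m.+1], so a circle of [m.+1]
    places suffices. One car more than places is a gain of one per turn. *)
Lemma card_prime_parking (m : nat) :
  #|[pred f : {ffun 'I_m.+2 -> 'I_m.+1} | ballot 1 m.+1 1 (fun i => f i)]| = m.+1 ^ m.+1.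
Proof.
apply/eqP; rewrite -(eqn_pmul2r (ltn0Sn m)) -expnSr.
rewrite -[X in _ == _ ^ X](card_ord m.+2); apply/eqP; apply: card_rot_unique => f.
have [A [Aper AE]] := below_rot f; rewrite card_ord in Aper.
have [c [Hc cuniq]] := cycle_ballot_gain (ltn0Sn m) Aper.
exists c; split=> [|d].
  by apply/ballotP => j jn; rewrite addn1 -(leq_add2l (A c)) -AE ?Hc //; lia.
move/ballotP => Hd; apply: cuniq => j jn.
by have := Hd j jn; rewrite addn1 AE ?leq_add2l //; lia.
Qed.

Lemma card_boundary (m : nat) :
  #|[pred f : {ffun 'I_m.+2 -> 'I_m.+3} |
      ballot 2 m.+2 0 (fun i => f i) & ~~ ballot 1 m.+2 0 (fun i => f i)]|
  = m.+1 ^ m.+1.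
Proof.
rewrite -card_prime_parking.
pose sh (g : {ffun 'I_m.+2 -> 'I_m.+1}) : {ffun 'I_m.+2 -> 'I_m.+3} :=
  [ffun i => inord (g i).+1].
have shE g i : sh g i = (g i).+1 :> nat.
  by rewrite ffunE inordK //; have := ltn_ord (g i); lia.
have below_sh g j : below (fun i => sh g i) j.+1 = below (fun i => g i) j.
  by apply: eq_card => i; rewrite !inE shE ltnS.
have sh_inj : injective sh.
  move=> g h E; apply/ffunP => i; apply/val_inj; apply: succn_inj.
  by rewrite -!shE E.
rewrite -(fintype.card_image sh_inj); apply: eq_card => f; rewrite !inE.
apply/andP/fintype.imageP => [[/ballotP H2 /ballotP H1]|[g /ballotP Hg ->]].
  (* The conditions from 2 on hold, so the one at 1 fails, and no entry is 0. *)
  have B1 : below (fun i => f i) 1 = 0.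
    apply: contra_notP H1 => /eqP B1 [//|[|j]] Hj; last exact: H2.
    by rewrite addn0 lt0n.
  have f_gt0 i : 0 < f i.
    by rewrite ltnNge; apply/negP => fi; have := card0_eq B1 i; rewrite !inE ltnS fi.
  (* The condition at [m.+2] bounds every entry, so the predecessors fit in ['I_m.+1] and [inord]
     never takes its default value. *)
  have f_lt i : f i < m.+2.
    by apply: (below_full (u := fun i => f i));
      rewrite card_ord -[leqLHS]addn0; apply: H2; rewrite leqnn.
  have fE : f = sh [ffun i => inord (f i).-1].
    apply/ffunP => i; apply/val_inj; rewrite /= shE ffunE inordK ?prednK ?f_gt0 //.
    exact: f_lt.
  exists [ffun i => inord (f i).-1] => //; apply/ballotP => j Hj.
  by rewrite -below_sh -fE addn1 -[leqLHS]addn0; apply: H2.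
split; last first.
  apply/ballotP => /(_ 1 isT); rewrite below_sh /below eq_card0 //.
apply/ballotP => -[|j] // Hj; rewrite below_sh addn0 -addn1; exact: Hg.
Qed.

(** * Monomials in the skeleton ideals *)

Lemma skeleton_idealX (K : fieldType) (n k : nat) (m : 'X_{1..n}) :
  skeleton_ideal K n k 'X_[m] <->
  exists s : {set 'I_n}, 1 <= #|s| <= k + 1 /\
    forall i, i \in s -> n - #|s| + 1 <= m i.
Proof.
pose e (s : {set 'I_n}) : 'X_{1..n} := (\sum_(i in s) U_(i) *+ (n - #|s| + 1))%MM.
have eE (s : {set 'I_n}) i : e s i = if i \in s then n - #|s| + 1 else 0.
  rewrite mnm_sumE big_mkcond (bigD1 i) //= big1 ?addn0.
    by case: ifP => // _; rewrite mulmnE mnm1E eqxx mul1n.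
  move=> j /negbTE ji; case: ifP => // _.
  by rewrite mulmnE mnm1E ji.
have genE s : m_gen K s = 'X_[e s] by exact: mprodXnE.
have dvdE s : (e s <= m)%MM <-> forall i, i \in s -> n - #|s| + 1 <= m i.
  split=> [/mnm_lepP H i si|H]; first by have := H i; rewrite eE si.
  by apply/mnm_lepP => i; rewrite eE; case: ifP => // si; apply: H.
split=> [[r [a [g [Hg mE]]]]|[s [cs /dvdE sm]]]; last first.
  exists 1, (fun=> 'X_[m - e s]%R), (fun=> m_gen K s); split.
    by move=> _; exists s.
  by rewrite big_ord1 genE -mpolyXD submK.
(* The coefficient at [m] is 1, so some summand has [m] in its support; the support of a multiple of
   a monomial consists of multiples of that monomial. *)
have : (\sum_(j < r) (a j * g j)@_m)%R != 0%R.
  by rewrite -raddf_sum /= -mE mcoeffX eqxx oner_neq0.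
move/negP => nz.
have [j] : exists j, ((a j * g j)@_m != 0)%R.
  apply: contra_notP nz => H; apply/eqP/big1 => j _.
  by apply/eqP; apply: contra_notT H => ?; exists j.
have [s cs <-] := Hg j; rewrite genE -mcoeff_msupp (perm_mem (msuppMX _ _)).
case/mapP => m' _ mD; exists s; split=> //; apply/dvdE.
by rewrite mD lem_addr.
Qed.

(** The entries not below [j] form the complement; any [c] of them can serve as the index set of a
    generator. *)
Lemma below_add_leP (I : finType) (u : I -> nat) (j c : nat) :
  below u j + c <= #|I| <->
  exists s : {set I}, #|s| = c /\ forall i, i \in s -> j <= u i.
Proof.
have <- : below u j + #|[pred i | j <= u i]| = #|I|.
  rewrite -(cardC [pred i | u i < j]); congr (_ + _).
  by apply: eq_card => i; rewrite !inE -leqNgt.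
rewrite leq_add2l; split=> [/card_geqP[s [us ss sub]]|[s [<- sub]]].
  exists [set x in s]%SET; split; first by rewrite cardsE (card_uniqP us).
  by move=> i; rewrite inE => /sub; rewrite inE.
by apply: subset_leq_card; apply/fintype.subsetP => i /sub; rewrite inE.
Qed.

(** Size [s] of an index set corresponds to [j = n - s + 1], so sizes 1 to [k + 1] become [j] from
    [n - k] to [n]. Having [s] exponents at least [j] leaves at most [j - 1] below [j], which is the
    failure of the ballot condition at [j]. *)
Lemma skeleton_ideal_ballot (K : fieldType) (n k : nat) (m : 'X_{1..n}) :
  k < n -> skeleton_ideal K n k 'X_[m] <-> ~~ ballot (n - k) n 0 m.
Proof.
move=> kn; rewrite skeleton_idealX; split=> [[s [/andP[s0 sk] sm]]|].
  apply/negP => /ballotP /(_ (n - #|s| + 1)).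
  have := iffRL (below_add_leP _ _ _) (ex_intro _ s (conj erefl sm)).
  have sn : #|s| <= n by rewrite -[leqRHS]card_ord max_card.
  rewrite card_ord addn0; set b := below _ _; lia.
move=> /allPn [j]; rewrite mem_index_iota addn0 ltnS => /andP[j1 jn]; rewrite -ltnNge => lt.
have [] := iffLR (below_add_leP m j (n - j + 1)); first by rewrite card_ord; lia.
move=> s [cs sm]; exists s; rewrite cs; split; first by lia.
by move=> i /sm; lia.
Qed.

Lemma stanE (K : fieldType) (n k : nat) : k < n ->
  stan K n k = [set 'X_[K, m] | m in [set m : 'X_{1..n} | ballot (n - k) n 0 m]].
Proof.
move=> kn; apply/seteqP; split=> [_ [[m _ <-] Hm]|_ [m Hm <-]].
  exists m => //=; apply/negPn/negP => H; apply: Hm.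
  exact/skeleton_ideal_ballot.
split; first by exists m.
by move/skeleton_ideal_ballot => /(_ kn); rewrite Hm.
Qed.

(** * From sets of monomials to finite counts *)

Lemma mpolyX_inj (K : fieldType) (n : nat) :
  injective (fun m : 'X_{1..n} => 'X_[K, m]).
Proof.
move=> m1 m2 /(congr1 (mcoeff m1)) /eqP; rewrite !mcoeffX eqxx.
by case: (m2 =P m1) => // _; rewrite oner_eq0.
Qed.

Lemma card_set_pred (T : finType) (P : pred T) : [set x | P x] #= `I_#|P|.
Proof.
have -> : [set x | P x] = [set enum_val i | i in [set: 'I_#|P|]].
  apply/seteqP; split=> [x Px|_ [i _ <-]]; last exact: enum_valP.
  by exists (enum_rank_in (A := P) Px x) => //; apply: enum_rankK_in.
rewrite (card_eql (inj_card_eq _)); last by move=> ? ? _ _; apply: enum_val_inj.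
by rewrite card_eq_sym card_II.
Qed.

(** The bound [b] turns exponent vectors into finite functions. [P] lives on plain functions so that
    it applies to both. *)
Lemma card_monomials (K : fieldType) (n b : nat) (P : pred ('I_n -> nat)) :
  (forall u, P u -> forall i, u i < b) ->
  [set 'X_[K, m] | m in [set m : 'X_{1..n} | P m]] #=
  `I_#|[pred f : {ffun 'I_n -> 'I_b} | P (fun i => f i)]|.
Proof.
move=> Pb.
pose mon (f : {ffun 'I_n -> 'I_b}) : 'X_{1..n} := [multinom f i : nat | i < n].
have monE f : mon f = (fun i => f i) :> ('I_n -> nat).
  by apply/funext => i; rewrite mnmE.
have -> : [set m : 'X_{1..n} | P m] =
    [set mon f | f in [set f : {ffun 'I_n -> 'I_b} | P (fun i => f i)]].
  apply/seteqP; split=> [m Pm|_ [f Pf <-]]; last by rewrite /= monE.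
  have E : mon [ffun i => Ordinal (Pb m Pm i)] = m.
    by apply/mnmP => i; rewrite mnmE ffunE.
  by exists [ffun i => Ordinal (Pb m Pm i)]; rewrite //= -monE E.
rewrite image_comp (card_eql (inj_card_eq _)); first exact: card_set_pred.
move=> f g _ _ /= /mpolyX_inj E; apply/ffunP => i; apply/val_inj.
by have := congr1 (fun m : 'X_{1..n} => m i) E; rewrite !mnmE.
Qed.

Lemma ballot_lt (n a : nat) (u : 'I_n -> nat) :
  a <= n -> ballot a n 0 u -> forall i, u i < n.
Proof.
move=> an /ballotP H; apply: below_full.
by rewrite card_ord -[leqLHS]addn0; apply: H; rewrite an leqnn.
Qed.

Theorem corollary3p9 (K : fieldType) (n : nat) (hn : (2 <= n)%N) :
  stan K n (n - 2) #= `I_((n + 1) ^ (n - 1) + (n - 1) ^ (n - 1))%N /\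
  bd_stan K n #= `I_((n - 1) ^ (n - 1))%N.
Proof.
case: n hn => [|[|p]] // _.
have E2 : stan K p.+2 (p.+2 - 2) =
    [set 'X_[K, m] | m in [set m : 'X_{1..p.+2} | ballot 2 p.+2 0 m]].
  by rewrite stanE; [congr image; rewrite subKn | lia].
have E1 : stan K p.+2 (p.+2 - 1) =
    [set 'X_[K, m] | m in [set m : 'X_{1..p.+2} | ballot 1 p.+2 0 m]].
  by rewrite stanE; [congr image; rewrite subKn | lia].
have Ebd : bd_stan K p.+2 = [set 'X_[K, m] | m in [set m : 'X_{1..p.+2} |
    (fun u : 'I_p.+2 -> nat => ballot 2 p.+2 0 u && ~~ ballot 1 p.+2 0 u) m]].
  rewrite /bd_stan E1 E2; apply/seteqP; split=> [_ [[m m2 <-] m1]|_ [m /andP[m2 m1] <-]].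
    by exists m => //=; rewrite [X in X && _]m2; apply/negP => H; apply: m1; exists m.
  split; first by exists m.
  by case=> m' /= H /mpolyX_inj E; move: m1; rewrite -E H.
(* The bound is relaxed from [p.+2] to [p.+3] to match the circle of [n + 1] places in
   [card_parking]. *)
have lt2 (u : 'I_p.+2 -> nat) : ballot 2 p.+2 0 u -> forall i, u i < p.+3.
  by move=> H i; apply/ltnW/(ballot_lt _ H).
have sub12 (u : 'I_p.+2 -> nat) : ballot 1 p.+2 0 u -> ballot 2 p.+2 0 u.
  by move/ballotP => H; apply/ballotP => j /andP[j2 jp]; apply: H; rewrite jp andbT ltnW.
rewrite addn1 subn1 /=; split; last first.
  rewrite Ebd -card_boundary.
  apply: (@card_monomials K p.+2 p.+3 (fun u => ballot 2 p.+2 0 u && ~~ ballot 1 p.+2 0 u)).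
  by move=> u /andP[/lt2].
have -> : p.+3 ^ p.+1 + p.+1 ^ p.+1 =
    #|[pred f : {ffun 'I_p.+2 -> 'I_p.+3} | ballot 2 p.+2 0 (fun i => f i)]|.
  rewrite -card_boundary -(card_parking (ltn0Sn p.+1)).
  (* Split by the condition at 1: parking functions on one side, the boundary on the other. *)
  rewrite -[in RHS](cardID
    [pred f : {ffun 'I_p.+2 -> 'I_p.+3} | ballot 1 p.+2 0 (fun i => f i)]).
  congr (_ + _); apply: eq_card => f; rewrite !inE //.
    by case b1 : (ballot 1 _ _ _); rewrite ?andbF // sub12.
  by rewrite andbC.
by rewrite E2; apply: (@card_monomials K p.+2 p.+3 (ballot 2 p.+2 0)).
Qed.
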